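(* Let $N = p^k m^2$ be an odd perfect number given in Eulerian form. Then $m^2 - p^k > 2m$.
   Context: A positive integer $N$ is an odd perfect number if $N$ is odd and $\sigma(N) = 2N$, where $\sigma$ denotes the sum-of-divisors function. An odd perfect number is said to be given in Eulerian form $N = p^k m^2$ if $p$ is a prime (the special prime), $k$ and $m$ are positive integers, $p \equiv k \equiv 1 \pmod 4$, and $\gcd(p,m) = 1$. *)

(* Defs.v *)
From mathcomp Require Import all_boot all_order all_algebra.

Set Implicit Arguments.
Unset Strict Implicit.
Unset Printing Implicit Defensive.

Definition sigma (n : nat) : nat := \sum_(d <- divisors n) d.

Definition odd_perfect (N : nat) : Prop :=
  [/\ 0 < N, odd N & sigma N = 2 * N].

Definition eulerian_form (N p k m : nat) : Prop :=
  [/\ N = p ^ k * m ^ 2,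
      prime p,
      0 < k /\ 0 < m,
      p = 1 %[mod 4] /\ k = 1 %[mod 4]
    & gcdn p m = 1].

(* Main.v *)
Require Import Defs.
From mathcomp Require Import all_boot all_order all_algebra.
From mathcomp Require Import zify.

(** Write [sigma (m ^ 2) = s * p ^ k], so that [sigma (p ^ k) * s = 2 * m ^ 2]
    with [s] odd.  If [s >= 3] then [p ^ k < 2 m^2 / 3], which suffices except
    for [m <= 5]; for [m = 1, 3, 5] the numbers [sigma (m ^ 2)] and [2 * m ^ 2]
    are coprime, forcing [s = 1].  If [s = 1] then, for every prime [q] with
    [q ^ e || m], the number [x = sigma (q ^ (2 e))] is a power of [p] with
    [q || x - 1], so lifting the exponent gives
    [2 e <= v_q (p ^ (k+1) - 1) <= v_q (x ^ (k+1) - 1) = 1 + v_q (k+1)].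
    Hence [m] divides [k+1], which contradicts [5 ^ k < 2 m^2]. *)

Lemma perm_divisorsM (a b : nat) : 0 < a -> 0 < b -> coprime a b ->
  perm_eq (divisors (a * b)) [seq x * y | x <- divisors a, y <- divisors b].
Proof.
move=> a0 b0 cab; apply: uniq_perm; first exact: divisors_uniq.
  apply: allpairs_uniq; try exact: divisors_uniq.
  (* Each factor is recovered from [x * y] as its gcd with [a] or [b]; the same gcds later split an
     arbitrary divisor of [a * b]. *)
  have split x y : x %| a -> y %| b -> gcdn (x * y) a = x /\ gcdn (x * y) b = y.
    move=> xa yb; split.
      rewrite gcdnC Gauss_gcdl; first exact/gcdn_idPr.
      by rewrite coprime_sym (coprime_dvdl yb) // coprime_sym.
    rewrite gcdnC Gauss_gcdr; first exact/gcdn_idPr.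
    by rewrite coprime_sym (coprime_dvdl xa).
  move=> [x y] [x' y'] /allpairsP[[u v] /= [ua vb [-> ->]]].
  move=> /allpairsP[[u' v'] /= [ua' vb' [-> ->]]] /= E.
  rewrite -!dvdn_divisors // in ua vb ua' vb'.
  have [E1 E2] := split _ _ ua vb; have [E3 E4] := split _ _ ua' vb'.
  by congr pair; [rewrite -E1 -E3 | rewrite -E2 -E4]; rewrite E.
move=> d; rewrite -dvdn_divisors ?muln_gt0 ?a0 //.
apply/idP/allpairsP => [dab | [[x y] /= [xa yb ->]]]; last first.
  by apply: dvdn_mul; rewrite dvdn_divisors.
exists (gcdn d a, gcdn d b); rewrite -!dvdn_divisors //= !dvdn_gcdr.
split=> //; apply/eqP; rewrite eqn_dvd; apply/andP; split.
  rewrite muln_gcdr dvdn_gcd dvdn_mull //= muln_gcdl dvdn_gcd dab.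
  by rewrite dvdn_mulr.
rewrite Gauss_dvd ?dvdn_gcdl //.
apply: (coprime_dvdl (dvdn_gcdr _ _)); rewrite coprime_sym.
by apply: (coprime_dvdl (dvdn_gcdr _ _)); rewrite coprime_sym.
Qed.

Lemma sigmaM (a b : nat) : 0 < a -> 0 < b -> coprime a b ->
  sigma (a * b) = sigma a * sigma b.
Proof.
move=> a0 b0 cab; rewrite /sigma (perm_big _ (perm_divisorsM _ _ a0 b0 cab)) /=.
rewrite big_allpairs_dep big_distrl /=; apply: eq_bigr => x _.
by rewrite big_distrr.
Qed.

Lemma sigmaX (p k : nat) : prime p -> sigma (p ^ k) = \sum_(i < k.+1) p ^ i.
Proof.
move=> pp; rewrite -(big_mkord xpredT (fun i => p ^ i)) /sigma /index_iota subn0.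
rewrite -(big_map (expn p) xpredT id); apply/perm_big/uniq_perm.
- exact: divisors_uniq.
- by rewrite map_inj_uniq ?iota_uniq //; apply/expnI/prime_gt1.
move=> d; rewrite -dvdn_divisors ?expn_gt0 ?prime_gt0 //.
apply/dvdn_pfactor/mapP => // -[i Hi ->]; exists i => //.
  by rewrite mem_iota ltnS.
by move: Hi; rewrite mem_iota ltnS.
Qed.

Lemma modn_sum (I : Type) (r : seq I) (F G : I -> nat) (d : nat) :
  (forall i, F i = G i %[mod d]) ->
  \sum_(i <- r) F i = \sum_(i <- r) G i %[mod d].
Proof.
move=> FG; elim/big_rec2: _ => // i x y _ E.
by rewrite -modnDm FG E modnDm.
Qed.

Lemma expn_add1_mod_sqr (q t i : nat) :
  (q * t).+1 ^ i = 1 + i * (q * t) %[mod q ^ 2].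
Proof.
elim: i => [|i IH]; first by rewrite mul0n.
rewrite expnS -modnMmr IH modnMmr.
rewrite (_ : _ * _ = i * t ^ 2 * q ^ 2 + (1 + i.+1 * (q * t))); last by nia.
by rewrite modnMDl.
Qed.

(** With [x = 1 + q * t], the sum is [q + q * t * (q * (q - 1) / 2)] modulo [q ^ 2]; as [q] is odd,
    the second term vanishes. *)
Lemma logn_geom_sum_prime (q x : nat) : prime q -> odd q -> q %| x.-1 -> 0 < x ->
  logn q (\sum_(i < q) x ^ i) = 1.
Proof.
move=> pq oq /dvdnP[t xt] x0.
have {xt} xE : x = (q * t).+1 by rewrite -[x]prednK // xt mulnC.
have q1 := prime_gt1 pq.
have E : \sum_(i < q) x ^ i = q %[mod q ^ 2].
  rewrite (modn_sum _ _ _ (fun i : 'I_q => 1 + i * (q * t))); last first.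
    by move=> i; rewrite xE expn_add1_mod_sqr.
  rewrite big_split /= sum1_card card_ord -big_distrl /=.
  rewrite -(big_mkord xpredT id) bin2_sum bin2odd //.
  rewrite (_ : _ + _ = q.-1./2 * t * q ^ 2 + q); last by nia.
  by rewrite modnMDl.
have S0 : 0 < \sum_(i < q) x ^ i.
  by rewrite (bigD1 (Ordinal (prime_gt0 pq))) //= expn0.
apply/eqP; rewrite eqn_leq -[_ <= 1]negbK -ltnNge -!pfactor_dvdn //.
apply/andP; split.
  by rewrite /dvdn E -/(dvdn _ _) gtnNdvd ?prime_gt0 // -[ltnLHS]muln1 ltn_pmul2l ?prime_gt0.
have : q %| q ^ 2 by rewrite dvdn_mulr.
by move/modn_dvdm => D; rewrite expn1 /dvdn -D E D modnn.
Qed.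

Lemma geom_sum_modn (q x n : nat) : q %| x.-1 -> 0 < x ->
  \sum_(i < n) x ^ i = n %[mod q].
Proof.
move=> /dvdnP[t xt] x0; have {xt} xE : x = t * q + 1 by rewrite -xt addn1 prednK.
rewrite (modn_sum _ _ _ (fun=> 1)) ?sum1_card ?card_ord // => i.
by rewrite -modnXm xE modnMDl modnXm exp1n.
Qed.

(** Lifting the exponent, by strong induction on [n]. If [q] does not divide [n], the cofactor of
    [x - 1] in [x ^ n - 1] is [n] modulo [q], hence prime to [q]. If [n = l * q], induction applies
    to [x ^ q] and [l], and passing from [x] to [x ^ q] adds one to the valuation. *)
Lemma logn_predX (q x n : nat) : prime q -> odd q -> q %| x.-1 -> 1 < x -> 0 < n ->
  logn q (x ^ n).-1 = logn q x.-1 + logn q n.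
Proof.
move=> pq oq; elim/ltn_ind: n x => n IH x qx x1 n0.
have x0 : 0 < x by apply: ltnW.
have S0 k : 0 < k -> 0 < \sum_(i < k) x ^ i.
  by move=> k0; rewrite (bigD1 (Ordinal k0)) //= expn0.
have px0 : 0 < x.-1 by lia.
case: (boolP (q %| n)) => [/dvdnP[l nE] | qn]; last first.
  rewrite predn_exp lognM // ?S0 //; congr addn.
  have L0 y : ~~ (q %| y) -> logn q y = 0 by rewrite lognE => /negPf->; rewrite !andbF.
  by rewrite !L0 // /dvdn geom_sum_modn.
have l0 : 0 < l by move: n0; rewrite nE; case: (l).
have xq1 : 1 < x ^ q by rewrite -(exp1n q) ltn_exp2r ?prime_gt0.
rewrite nE mulnC expnM IH //; first last.
- by apply: dvdn_trans qx (dvdn_pred_predX _ _).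
- by rewrite nE -[ltnLHS]muln1 ltn_pmul2l ?prime_gt1.
have q0 := prime_gt0 pq.
rewrite predn_exp !lognM ?S0 // logn_geom_sum_prime //.
by rewrite (logn_prime _ pq) eqxx addnA.
Qed.

Lemma coprime_prime_sigmaX (p k : nat) : prime p -> coprime p (sigma (p ^ k)).
Proof.
move=> pp; rewrite sigmaX // big_ord_recl expn0.
rewrite (eq_bigr (fun i : 'I_k => p * p ^ i)); last by move=> i _; rewrite expnS.
by rewrite -big_distrr /= addnC prime_coprime // dvdn_addr ?dvdn_mulr // dvdn1 neq_ltn prime_gt1 ?orbT.
Qed.

Lemma odd_sigmaX (p k : nat) : prime p -> odd p -> odd (sigma (p ^ k)) = ~~ odd k.
Proof.
move=> pp op; rewrite sigmaX //; elim: k => [|k IH]; first by rewrite big_ord1.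
by rewrite big_ord_recr /= oddD IH oddX op orbT addbT.
Qed.

Lemma sigmaX_gt (p k : nat) : prime p -> 0 < k -> p ^ k < sigma (p ^ k).
Proof.
move=> pp; case: k => // k _.
by rewrite sigmaX // big_ord_recr big_ord_recl expn0 /= -addnA add1n ltnS leq_addl.
Qed.

(** Removing the term 1 leaves [q + q ^ 2 + ... + q ^ e = q * (1 + q * S)]. *)
Lemma logn_pred_sigmaX (q e : nat) : prime q -> 1 < e ->
  logn q (sigma (q ^ e)).-1 = 1.
Proof.
move=> pq; case: e => [|[|e]] // _.
rewrite sigmaX // 2!big_ord_recl expn0 expn1.
rewrite (eq_bigr (fun i : 'I_e.+1 => q * (q * q ^ i))); last first.
  by move=> i _; rewrite !expnS.
rewrite -!big_distrr /=; set S := \sum_(i < _) _.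
rewrite (_ : 0 + _ = q * (q * S + 1)); last by nia.
rewrite lognM ?addn1 ?(prime_gt0 pq) // (logn_prime _ pq) eqxx lognE pq /=.
rewrite -[(q * S).+1]addn1 dvdn_addr ?dvdn_mulr // dvdn1.
by rewrite (gtn_eqF (prime_gt1 pq)).
Qed.

Lemma dvdn_succ_of_sigma_eq (p k m : nat) : prime p -> odd m -> 0 < m ->
  sigma (m ^ 2) = p ^ k -> sigma (p ^ k) = 2 * m ^ 2 -> m %| k.+1.
Proof.
move=> pp om m0 Em Ep; apply/dvdn_partP => // q.
rewrite mem_primes => /and3P[pq _ qm]; rewrite p_part pfactor_dvdn //.
set e := logn q m.
have e0 : 0 < e by rewrite logn_gt0 mem_primes pq m0.
have oq : odd q by apply: dvdn_odd qm om.
have [m' qm' mE] := pfactor_coprime pq m0; rewrite -/e in mE.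
have m'0 : 0 < m' by move: m0; rewrite mE; case: (m').
have xp : sigma (q ^ (2 * e)) %| p ^ k.
  have -> : p ^ k = sigma (q ^ (2 * e) * m' ^ 2).
    by rewrite -Em mE expnMn -expnM [e * 2]mulnC [m' ^ 2 * _]mulnC.
  rewrite sigmaM ?expn_gt0 ?m'0 ?(prime_gt0 pq) ?dvdn_mulr //.
  by rewrite coprimeXl // coprimeXr.
have [c _ xE] := dvdn_pfactor _ _ pp xp.
have x1 : 1 < sigma (q ^ (2 * e)).
  apply: leq_trans (sigmaX_gt _ _ pq _); last by rewrite muln_gt0.
  by rewrite ltnS expn_gt0 prime_gt0.
have Lx : logn q (sigma (q ^ (2 * e))).-1 = 1 by apply: logn_pred_sigmaX => //; lia.
have qx : q %| (sigma (q ^ (2 * e))).-1.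
  have : 0 < logn q (sigma (q ^ (2 * e))).-1 by rewrite Lx.
  by rewrite logn_gt0 mem_primes => /and3P[].
have LTE := logn_predX _ _ k.+1 pq oq qx x1 isT.
(* As [sigma (q ^ (2 * e)) = p ^ c], the right side is a multiple of [p ^ k.+1 - 1 = (p - 1) * sigma
   (p ^ k) = (p - 1) * 2 * m ^ 2]. *)
have D : q ^ (2 * e) %| (sigma (q ^ (2 * e)) ^ k.+1).-1.
  rewrite xE -expnM [c * _]mulnC [p ^ _]expnM.
  apply: dvdn_trans (dvdn_pred_predX (p ^ k.+1) c).
  rewrite predn_exp -sigmaX // Ep dvdn_mull // dvdn_mull //.
  by rewrite [2 * e]mulnC expnM dvdn_exp2r // pfactor_dvdnn.
move: D; rewrite pfactor_dvdn //; last first.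
  rewrite -subn1 subn_gt0; apply: (leq_trans x1).
  by rewrite -[leqLHS]expn1 leq_pexp2l // ltnW.
(* From [2 * e <= 1 + logn q k.+1] and [1 <= e] follows [e <= logn q k.+1]. *)
by rewrite LTE Lx; lia.
Qed.

Lemma sqr_succ_lt_exp5 (k : nat) : 1 < k -> 2 * k.+1 ^ 2 < 5 ^ k.
Proof.
case: k => [|[|k]] // _; elim: k => // k IH.
by rewrite [5 ^ _]expnS; apply: (@leq_trans (5 * (2 * k.+3 ^ 2).+1)); [nia | rewrite leq_mul2l].
Qed.

(** Since [m <= k + 1], [5 ^ k <= p ^ k < 2 * m ^ 2 <= 2 * (k + 1) ^ 2], which fails for [k >= 2].
    For [k = 1], oddness forces [m = 1], so [p < 2]. *)
Lemma sigma_pair_absurd (p k m : nat) : prime p -> 4 < p -> odd m -> 0 < k ->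
  sigma (m ^ 2) = p ^ k -> sigma (p ^ k) = 2 * m ^ 2 -> False.
Proof.
move=> pp p5 om k0 Em Ep.
have m0 : 0 < m by case: (m) om.
have /dvdn_leq mk := dvdn_succ_of_sigma_eq _ _ _ pp om m0 Em Ep.
have {mk} mk := mk isT.
have := sigmaX_gt _ _ pp k0; rewrite Ep => lt1.
have lt2 : 5 ^ k <= p ^ k by rewrite leq_exp2r.
have [k1 | k1] := leqP k 1.
  have kE : k = 1 by lia.
  have mE : m = 1 by move: mk om; rewrite kE; case: (m) => [|[|[|]]].
  by move: lt1 lt2; rewrite kE mE; lia.
by have := sqr_succ_lt_exp5 _ k1; nia.
Qed.

(** The pairs are 1 and 2, 13 and 18, 31 and 50. *)
Lemma coprime_small_sigma (m : nat) : odd m -> m < 6 ->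
  coprime (sigma (m ^ 2)) (2 * m ^ 2).
Proof.
case: m => [|[|[|[|[|[|]]]]]] // _ _.
- by rewrite /sigma (_ : divisors _ = [:: 1]) // big_seq1.
- by rewrite sigmaX // !big_ord_recr big_ord0.
- by rewrite sigmaX // !big_ord_recr big_ord0.
Qed.

(* The difference m^2 - p^k is taken in int, so it is not truncated. *)
Theorem theorem3 (N p k m : nat)
    (hN : odd_perfect N) (hE : eulerian_form N p k m) :
  (m%:Z ^+ 2 - p%:Z ^+ k > 2 * m%:Z)%R.
Proof.
case: hN => _ oN sN; case: hE => NE pp [k0 m0] [p4 k4] /eqP cpm.
have op : odd p by rewrite (divn_eq p 4) p4 oddD oddM andbF.
have ok : odd k by rewrite (divn_eq k 4) k4 oddD oddM andbF.
have p5 : 4 < p by move: (prime_gt1 pp) p4; case: (p) => [|[|[|[|[|]]]]].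
have om : odd m by move: oN; rewrite NE oddM !oddX /= => /andP[].
have E : sigma (p ^ k) * sigma (m ^ 2) = p ^ k * (2 * m ^ 2).
  rewrite -sigmaM ?expn_gt0 ?m0 ?(prime_gt0 pp) //; last by rewrite coprimeXl // coprimeXr.
  by rewrite -NE sN NE; lia.
have /dvdnP[s sE] : p ^ k %| sigma (m ^ 2).
  rewrite -(Gauss_dvdr _ (_ : coprime _ (sigma (p ^ k)))) ?E ?dvdn_mulr //.
  by rewrite coprimeXl // coprime_prime_sigmaX.
have pk0 : 0 < p ^ k by rewrite expn_gt0 prime_gt0.
have sE2 : sigma (p ^ k) * s = 2 * m ^ 2.
  by apply/eqP; rewrite -(eqn_pmul2l pk0) -E sE; apply/eqP; lia.
have esig : odd (sigma (p ^ k)) = false by rewrite odd_sigmaX ?ok.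
(* [sigma (p ^ k)] is even, while [2 * m ^ 2] has a single factor 2. *)
have os : odd s.
  have om2 : odd (m ^ 2) by rewrite oddX.
  by move: sE2 esig om2; move: (sigma _) (m ^ 2) => a b; nia.
have s1 : s <> 1.
  move=> sE1; move: sE sE2; rewrite sE1 mul1n muln1 => Em Ep.
  exact: (sigma_pair_absurd _ _ _ pp p5 om k0 Em Ep).
(* [s] divides both [sigma (m ^ 2)] and [2 * m ^ 2], so coprimality would give [s = 1]. *)
have m6 : 5 < m.
  rewrite ltnNge; apply/negP => m5; apply: s1; apply/eqP; rewrite -dvdn1.
  rewrite -(eqP (coprime_small_sigma _ om m5)) dvdn_gcd sE dvdn_mulr //=.
  by rewrite -sE2 dvdn_mull.
have s3 : 2 < s by case: (s) os s1 => [|[|[|]]].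
have lt := sigmaX_gt _ _ pp k0.
have {lt s3 sE2} main : 3 * (p ^ k).+1 <= 2 * m ^ 2.
  by rewrite -sE2 mulnC leq_mul.
(* Thus [2 * m] is at most a third of [m ^ 2], and [p ^ k + 1] at most two thirds; adding the two
   gives the strict bound. *)
have sq : 6 * m <= m ^ 2 by rewrite leq_mul2r m6 orbT.
have {}main : 2 * m + p ^ k < m ^ 2 by move: (p ^ k) (m ^ 2) main sq => a b; lia.
rewrite -2!natz -!GRing.natrX !natz.
by move: (p ^ k) (m ^ 2) main => a b; lia.
Qed.
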